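(* Let $(d,m)$ be a pair of integers satisfying one of: $m=3$ and $3\le d\le6$; $m=4$ and $7\le d\le10$; $m=5$ and $11\le d\le14$; $m=6$ and $15\le d\le18$; $m=7$ and $19\le d\le22$; $m=8$ and $23\le d\le26$. Then there exist nonnegative rational numbers $\lambda_1,\dots,\lambda_5$ with $\sum_{i=1}^5\lambda_i=1$ such that \begin{align*} \int_{\mathbb{S}^d}f\,d\bar\sigma={}&\lambda_1M_f\big(\tfrac1{\sqrt{d+1}}v_{d+1}\big)+\lambda_2M_f(v_1)+\lambda_3M_f\big(\tfrac1{\sqrt2}v_2\big)+\lambda_4M_f\big(\tfrac1{\sqrt m}v_m\big)\\ &+\lambda_5M_f\big(\tfrac1{\sqrt{9+d}}(3,1,\dots,1)\big) \end{align*} for every polynomial $f$ in $d+1$ variables of degree at most $9$. Consequently, for every integer $3\le d\le26$ there exist finitely many positive rational numbers $c_i$ and linear forms $L_i$ in $x_1,\dots,x_{d+1}$ with rational coefficients such that $$(x_1^2+\dots+x_{d+1}^2)^4=\sum_ic_iL_i(x)^8 .$$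
   Context: $\mathbb{S}^d$ is the unit sphere of $\mathbb{R}^{d+1}$ and $\bar\sigma$ its rotation-invariant probability measure (normalized surface measure). $v_k=(1,\dots,1,0,\dots,0)\in\mathbb{R}^{d+1}$ ($k$ ones), and $(3,1,\dots,1)\in\mathbb{R}^{d+1}$. For $y\in\mathbb{R}^{d+1}$, $M_f(y)$ denotes the average of $f$ over the set of distinct points obtained from $y$ by permuting coordinates and changing signs of coordinates arbitrarily. Orbits whose coefficient $\lambda_i$ vanishes are omitted from the rule. *)

(* Defs.v *)
From HB Require Import structures.
From mathcomp Require Import all_boot all_order all_algebra perm.
From mathcomp Require Import all_classical all_reals all_analysis.
From mathcomp Require Import -(notations) mpoly.

Set Implicit Arguments.
Unset Strict Implicit.
Unset Printing Implicit Defensive.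

Import Order.TTheory GRing.Theory Num.Theory.

Local Open Scope classical_set_scope.
Local Open Scope ring_scope.

(* R^n is [n.-tuple R], the library's type of vectors that carries the product
   sigma-algebra, which is here the Borel one.  The notations of the
   polynomial library clash with those of the analysis library and are left
   out: [mpoly.mpoly n R] is the ring R[x_1, ..., x_n]. *)

Section Vectors.
Context {R : realType} {n : nat}.
Implicit Types (x y : n.-tuple R).

Definition unit_sphere : set (n.-tuple R) :=
  [set x | \sum_(i < n) tnth x i ^+ 2 = 1].

Definition linear_map (Q : 'M[R]_n) x : n.-tuple R :=
  [tuple \sum_(j < n) Q i j * tnth x j | i < n].

Definition is_rotation (Q : 'M[R]_n) : Prop :=
  Q *m Q^T = 1%:M /\ \det Q = 1.

(* The rotation-invariant probability measure on the sphere, seen as a measure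
   on the ambient space; for n >= 2 these conditions determine it uniquely. *)
Definition is_uniform_on_sphere (sigma : probability (n.-tuple R) R) : Prop :=
  sigma unit_sphere = 1%E /\
  forall Q : 'M[R]_n, is_rotation Q ->
  forall A : set (n.-tuple R), measurable A ->
    sigma (linear_map Q @^-1` A) = sigma A.

Definition scale_vec (a : R) x : n.-tuple R := [tuple a * tnth x i | i < n].

Definition ones_vec (k : nat) : n.-tuple R := [tuple (i < k)%N%:R | i < n].

Definition three_ones_vec : n.-tuple R :=
  [tuple (if i == 0%N :> nat then 3 else 1) | i < n].

Definition signed_perm (e : {ffun 'I_n -> bool}) (s : 'S_n) x : n.-tuple R :=
  [tuple (-1) ^+ e i * tnth x (s i) | i < n].

(* [undup]: each point of the orbit counts once, whatever its stabilizer. *)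
Definition signed_perm_orbit y : seq (n.-tuple R) :=
  undup [seq signed_perm p.1 p.2 y | p : {ffun 'I_n -> bool} * 'S_n].

Definition orbit_mean (f : n.-tuple R -> R) y : R :=
  (\sum_(z <- signed_perm_orbit y) f z) / (size (signed_perm_orbit y))%:R.

Definition poly_fun (f : mpoly.mpoly n R) x : R := mpoly.meval (tnth x) f.

End Vectors.

Definition admissible_pair (d m : nat) : bool :=
  [|| (m == 3) && (3 <= d <= 6),
      (m == 4) && (7 <= d <= 10),
      (m == 5) && (11 <= d <= 14),
      (m == 6) && (15 <= d <= 18),
      (m == 7) && (19 <= d <= 22) |
      (m == 8) && (23 <= d <= 26)]%N.

(* [mpoly.msize f] is one more than the degree of [f], and 0 if [f] is 0. *)
Definition degree_le (R : realType) (n k : nat) (f : mpoly.mpoly n R) : bool :=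
  (mpoly.msize f <= k.+1)%N.

Definition mvar (n : nat) (i : 'I_n) : mpoly.mpoly n rat :=
  mpoly.mpolyX rat (mpoly.mnm1 i).

Definition linear_form (n : nat) (a : 'I_n -> rat) : mpoly.mpoly n rat :=
  \sum_(i < n) a i *: mvar i.

(* Main.v *)
Require Import Defs.
From HB Require Import structures.
From mathcomp Require Import all_boot all_order all_algebra perm.
From mathcomp Require Import all_classical all_reals all_analysis.
From mathcomp Require Import -(notations) mpoly.
From mathcomp Require Import measurable_realfun ring lra zify.

(** A rotation-invariant integral over the sphere is determined on monomials:
    the coefficient of t in the invariance under a plane rotation of rational
    parameter t relates the exponents a + 2 e_i and a + 2 e_j, and |x|^2 = 1
    closes the recursion, so the moments are products of Gaussian moments up to
    a factor depending on the degree only.  The orbit means of the rule vanish on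
    monomials with an odd exponent as well, and |x|^2 = 1 lifts degrees 0, 2, 4
    and 6 to degree 8.  There the exponents 2b fall into five types, the
    partitions of 4, whence five linear equations for the five weights.  The
    representation of (x_1^2 + ... + x_n^2)^4 is the same moment identity read
    through the multinomial expansion of L(x)^8, which needs no integral. *)

Set Implicit Arguments.
Unset Strict Implicit.
Unset Printing Implicit Defensive.

Import Order.TTheory GRing.Theory Num.Theory.

Local Open Scope classical_set_scope.
Local Open Scope ring_scope.

(** * Means over signed permutations *)

Fixpoint gauss_moment (k : nat) : nat :=
  match k with
  | 0 => 1
  | 1 => 0
  | k'.+2 => k'.+1 * gauss_moment k'
  end.

Lemma gauss_moment_odd k : odd k -> gauss_moment k = 0%N.
Proof.
elim/ltn_ind: k => -[|[|k]] IH //=; rewrite negbK => ok.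
by rewrite IH ?muln0.
Qed.

Lemma fact_double_gauss k : ((k.*2)`! = 2 ^ k * k`! * gauss_moment k.*2)%N.
Proof.
elim: k => [|k IH] //; rewrite doubleS !factS IH expnS /=.
rewrite (_ : k.*2.+2 = 2 * k.+1)%N; last by lia.
ring.
Qed.

Section PermSums.
Variable n : nat.

Lemma sum_perm_at (g : 'I_n -> nat) (j : 'I_n) :
  (n * \sum_(s : 'S_n) g (s j) = n`! * \sum_i g i)%N.
Proof.
have indep k : (\sum_(s : 'S_n) g (s k) = \sum_(s : 'S_n) g (s j))%N.
  rewrite (reindex_inj (mulgI (tperm j k))) /=.
  by apply: eq_bigr => s _; rewrite permM tpermR.
transitivity (\sum_(k < n) \sum_(s : 'S_n) g (s k))%N.
  by rewrite (eq_bigr _ (fun k _ => indep k)) sum_nat_const card_ord.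
rewrite exchange_big /=.
rewrite (eq_bigr (fun=> \sum_i g i)%N) => [|s _]; last first.
  by rewrite [RHS](reindex_inj (@perm_inj _ s)).
by rewrite sum_nat_const card_Sn.
Qed.

Lemma sum_perm_ffact (k : nat) (A : {set 'I_n}) : (k <= n)%N ->
  ((\sum_(s : 'S_n) \prod_(i in A) (s i < k)%N) * n ^_ #|A| = k ^_ #|A| * n`!)%N.
Proof.
move=> kn; pose T (A : {set 'I_n}) := (\sum_(s : 'S_n) \prod_(i in A) (s i < k)%N)%N.
have step (B : {set 'I_n}) j : j \notin B ->
    ((n - #|B|) * T (j |: B) = (k - #|B|) * T B)%N.
  move=> jB.
  have indep l : l \in ~: B -> T (l |: B) = T (j |: B).
    rewrite inE => lB; rewrite /T (reindex_inj (mulgI (tperm j l))) /=.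
    apply: eq_bigr => s _; rewrite !big_setU1 //= permM tpermR; congr (_ * _)%N.
    apply: eq_bigr => i iB; rewrite permM tpermD //.
      by apply: contraNneq jB => ->.
    by apply: contraNneq lB => ->.
  transitivity (\sum_(l in ~: B) T (l |: B))%N.
    rewrite (eq_bigr _ indep) sum_nat_const; congr (_ * _)%N.
    by rewrite -[X in (X - _)%N](card_ord n) -(cardsC B) addKn.
  rewrite exchange_big /= big_distrr /=; apply: eq_bigr => s _.
  rewrite (eq_bigr (fun l : 'I_n => (s l < k) * \prod_(i in B) (s i < k))%N); last first.
    by move=> l; rewrite inE => lB; rewrite big_setU1.
  rewrite -big_distrl /=.
  have [/forallP sB|] := boolP [forall (i | i \in B), s i < k]%N; last first.
    rewrite negb_forall => /existsP[i]; rewrite negb_imply => /andP[iB /negPf si].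
    by rewrite (bigD1 i iB) /= si mul0n !muln0.
  congr (_ * _)%N.
  have tot : (\sum_i (s i < k) = k)%N.
    transitivity (\sum_(i < n) (i < k))%N.
      by rewrite [RHS](reindex_inj (@perm_inj _ s)).
    rewrite -[RHS]card_ord -sum1_card (big_ord_widen _ (fun=> 1%N) kn).
    by rewrite [RHS]big_mkcond; apply: eq_bigr => i _; case: (i < k)%N.
  have onB : (\sum_(i in B) (s i < k) = #|B|)%N.
    rewrite -sum1_card; apply: eq_bigr => i iB.
    by have := sB i; rewrite iB /= => ->.
  rewrite -[X in (X - _)%N]tot [in RHS](bigID (mem B)) /= onB addKn.
  by apply: eq_bigl => i; rewrite inE.
have [r] := ubnP #|A|; elim: r A => // r IH A.
have [->|[j jA]] := set_0Vmem A.
  move=> _; rewrite cards0 !ffactn0 muln1 mul1n.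
  rewrite (eq_bigr (fun=> 1%N)) => [|s _]; last by rewrite big_set0.
  by rewrite sum_nat_const card_Sn muln1.
rewrite -(finset.setD1K jA) cardsU1 finset.setD11 add1n ltnS => Ar.
have := step (A :\ j) j; rewrite finset.setD11 => /(_ isT) st.
rewrite !ffactnSr -/(T _) (mulnC (n ^_ _)) mulnA (mulnC (T _)) st -mulnA.
have {}IH := IH _ Ar; rewrite -/(T _) in IH.
by rewrite IH mulnA (mulnC (k - _)%N).
Qed.

End PermSums.

Section SignedMean.
Variables (n : nat) (F : numFieldType).
Implicit Types (y : 'I_n -> F) (a : mpoly.multinom n).

(* The mean over the whole group of signed permutations; the orbit mean agrees
   with it because all fibres of the orbit map have the same size. *)
Definition signed_mean y a : F :=
  (\sum_(p : {ffun 'I_n -> bool} * 'S_n)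
      \prod_i ((-1) ^+ p.1 i * y (p.2 i)) ^+ a i)
    / #|{: {ffun 'I_n -> bool} * 'S_n}|%:R.

Lemma signed_meanE y a :
  signed_mean y a =
    if [forall i, ~~ odd (a i)] then
      (\sum_(s : 'S_n) \prod_i y (s i) ^+ a i) / n`!%:R
    else 0.
Proof.
rewrite /signed_mean.
have -> : (#|{: {ffun 'I_n -> bool} * 'S_n}| = 2 ^ n * n`!)%N.
  by rewrite card_prod card_ffun card_bool card_ord card_Sn.
rewrite (eq_bigr (fun p : {ffun 'I_n -> bool} * 'S_n =>
  (\prod_i (-1 : F) ^+ (p.1 i * a i)) * \prod_i y (p.2 i) ^+ a i)); last first.
  by move=> p _; rewrite -big_split /=; apply: eq_bigr => i _; rewrite exprMn exprM.
rewrite -(pair_bigA _ (fun (e : {ffun 'I_n -> bool}) (s : 'S_n) =>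
  (\prod_i (-1 : F) ^+ (e i * a i)) * \prod_i y (s i) ^+ a i)) /=.
rewrite -big_distrlr /=.
rewrite -(bigA_distr_bigA (fun (i : 'I_n) (b : bool) => (-1 : F) ^+ (b * a i))) /=.
have sgn i : \sum_(b : bool) (-1 : F) ^+ (b * a i) = (~~ odd (a i)).*2%:R.
  rewrite big_bool mul1n mul0n expr0 -signr_odd.
  by case: (odd _); rewrite /= ?addNr.
rewrite (eq_bigr _ (fun i _ => sgn i)).
case: ifPn => [/forallP ev | ].
  rewrite (eq_bigr (fun=> 2%:R)) => [|i _]; last by rewrite ev.
  by rewrite prodr_const card_ord natrM natrX invfM mulrACA divff ?mul1r.
rewrite negb_forall => /existsP[i]; rewrite negbK => oi.
by rewrite (bigD1 i) //= oi !mul0r.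
Qed.

Lemma signed_mean_odd y a i : odd (a i) -> signed_mean y a = 0.
Proof.
move=> oi; rewrite signed_meanE ifN // negb_forall.
by apply/existsP; exists i; rewrite negbK.
Qed.

Lemma signed_mean_ones (k : nat) a : (k <= n)%N -> (forall i, ~~ odd (a i)) ->
  let r := #|[set i | (0 < a i)%N]%SET| in
  signed_mean (fun i => (i < k)%N%:R) a = (k ^_ r)%:R / (n ^_ r)%:R.
Proof.
move=> kn ev /=; rewrite signed_meanE ifT; last exact/forallP.
set A := [set i | _]%SET.
have An : (#|A| <= n)%N by rewrite -[X in (_ <= X)%N]card_ord max_card.
have := sum_perm_ffact A kn.
have -> : \sum_(s : 'S_n) \prod_i ((s i < k)%N%:R : F) ^+ a i =
          (\sum_(s : 'S_n) \prod_(i in A) (s i < k)%N)%N%:R.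
  rewrite natr_sum; apply: eq_bigr => s _; rewrite natr_prod [RHS]big_mkcond.
  apply: eq_bigr => i _; rewrite inE; case: (ltnP 0 (a i)) => [ai|].
    case: (s i < k)%N; first by rewrite expr1n.
    by rewrite expr0n eqn0Ngt ai.
  by rewrite leqn0 => /eqP ->; rewrite expr0.
move/(congr1 (fun k : nat => k%:R : F)); rewrite !natrM => E.
have n0 : (n ^_ #|A|)%:R != 0 :> F by rewrite pnatr_eq0 -lt0n ffact_gt0.
have f0 : n`!%:R != 0 :> F by rewrite pnatr_eq0 -lt0n fact_gt0.
by apply/eqP; rewrite eqr_div //; apply/eqP; rewrite E.
Qed.

Lemma signed_mean_three a : (0 < n)%N -> (forall i, ~~ odd (a i)) ->
  signed_mean (fun i => if i == 0%N :> nat then 3 else 1) a =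
    (\sum_i 3 ^ a i)%N%:R / n%:R.
Proof.
move=> n_gt0 ev; rewrite signed_meanE ifT; last exact/forallP.
pose o := Ordinal n_gt0.
have n0 : n%:R != 0 :> F by rewrite pnatr_eq0 -lt0n.
have f0 : n`!%:R != 0 :> F by rewrite pnatr_eq0 -lt0n fact_gt0.
apply/eqP; rewrite eqr_div // mulrC [X in _ == X]mulrC; apply/eqP.
have -> : \sum_(s : 'S_n) \prod_i (if s i == 0%N :> nat then 3 else 1 : F) ^+ a i =
          (\sum_(s : 'S_n) 3 ^ a (s o))%N%:R.
  rewrite (reindex_inj (invg_inj : injective (fun s : 'S_n => s^-1%g))) natr_sum /=.
  apply: eq_bigr => s _.
  rewrite (bigD1 (s o)) //= permK eqxx natrX big1 ?mulr1 // => i si.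
  rewrite ifN ?expr1n //; apply: contra si => /eqP s0.
  by rewrite -(permKV s i); apply/eqP; congr (s _); apply/val_inj.
by rewrite -!natrM (sum_perm_at (fun i => 3 ^ a i)%N).
Qed.

Lemma signed_mean_scale c y a :
  signed_mean (fun i => c * y i) a = c ^+ mpoly.mdeg a * signed_mean y a.
Proof.
rewrite /signed_mean mulrA; congr (_ / _); rewrite big_distrr /=.
apply: eq_bigr => p _; rewrite mpoly.mdegE -prodrXr -big_split /=.
by apply: eq_bigr => i _; rewrite mulrCA exprMn.
Qed.

Lemma signed_mean_sphere y a : \sum_i y i ^+ 2 = 1 ->
  \sum_j signed_mean y (mpoly.mnm_add a (mpoly.mnm_muln (mpoly.mnm1 j) 2)) =
  signed_mean y a.
Proof.
move=> y1; rewrite /signed_mean -mulr_suml; congr (_ / _).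
rewrite exchange_big /=; apply: eq_bigr => p _.
have {}y1 : \sum_j y (p.2 j) ^+ 2 = 1.
  by rewrite -y1 [RHS](reindex_inj (@perm_inj _ p.2)).
rewrite -[RHS]mul1r -[X in _ = X * _]y1 big_distrl /=.
apply: eq_bigr => j _; rewrite (bigD1 j) //= [in RHS](bigD1 j) //= mulrA.
congr (_ * _).
  rewrite mpoly.mnmDE mpoly.mulmnE mpoly.mnm1E eqxx mul1n exprD mulrC.
  by congr (_ * _); rewrite exprMn -exprM mulnC exprM sqrrN expr1n expr1n mul1r.
apply: eq_bigr => i ij; rewrite mpoly.mnmDE mpoly.mulmnE mpoly.mnm1E.
by rewrite eq_sym (negPf ij) mul0n addn0.
Qed.

End SignedMean.

Lemma signed_mean_ratr n (R : numFieldType) (y : 'I_n -> rat) a :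
  signed_mean (fun i => ratr (y i) : R) a = ratr (signed_mean y a).
Proof.
rewrite /signed_mean fmorph_div rmorph_nat rmorph_sum /=; congr (_ / _).
apply: eq_bigr => p _; rewrite rmorph_prod; apply: eq_bigr => i _.
by rewrite rmorphXn rmorphM rmorph_sign.
Qed.

(** * The weights *)

Section Weights.
Variable F : numFieldType.
Implicit Types N M : F.

Definition sphere_norm8 N := N * (N + 2) * (N + 4) * (N + 6).

(* The weights solve the five equations of [weights_moment8]: the two with
   support size 2 give [weight_three], subtracting those with support sizes 3 and
   4 gives [weight_m], and the others follow one by one.  They refer to nodes with
   integer coordinates, that is, before division by the norms. *)
Definition weight_three N := (96 * (N + 2) * (N + 4) * (N + 6))^-1.

Definition weight_m N M :=
  4 * (N - 1) * (N - 2) * (N - 3)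
    / (3 * (N + 2) * (N + 4) * (N + 6) * M * (M - 1) * (M - 2) * (N - M)).

Definition num_ones N M := (64 - N) * (N - M) - 128 * (M - 3).

Definition weight_ones N M := num_ones N M / (96 * sphere_norm8 N * (N - M)).

Definition num_two N M :=
  5 * (N - M) * (M - 2) + (M - 3) * (M - 2) - (N - 2) * (N - 3).

Definition weight_two N M :=
  2 * N * (N - 1) * num_two N M / (3 * sphere_norm8 N * (M - 2) * (N - M)).

Definition num_one N M :=
  27 * (M - 1) * (M - 2) * (N - M) + (M - 1) * (M - 2) * (M - 3)
    - (M - 1) * (N - 1) * num_two N M - (N - 1) * (N - 2) * (N - 3).

Definition weight_one N M :=
  4 * N * num_one N M
    / (3 * sphere_norm8 N * (M - 1) * (M - 2) * (N - M)).

End Weights.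

(* For each partition b of k: the number of its parts, the sum of the
   (9 ^ b_i - 1) / 8, and the product of the (2 b_i - 1)!!. *)
Definition exponent_types (k : nat) : seq (nat * nat * nat) :=
  match k with
  | 0 => [:: (0, 0, 1)]
  | 1 => [:: (1, 1, 1)]
  | 2 => [:: (1, 10, 3); (2, 2, 1)]
  | 3 => [:: (1, 91, 15); (2, 11, 3); (3, 3, 1)]
  | 4 => [:: (1, 820, 105); (2, 92, 15); (2, 20, 9); (3, 12, 3); (4, 4, 1)]
  | _ => [::]
  end%N.

Lemma exponent_typesP (s : seq nat) k : (\sum_(b <- s) b = k)%N -> (k <= 4)%N ->
  (\sum_(b <- s) (0 < b), \sum_(b <- s) (9 ^ b).-1 %/ 8,
     \prod_(b <- s) gauss_moment b.*2)%N \in exponent_types k.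
Proof.
elim: s k => [|x s IH] k; first by rewrite !big_nil => <-.
rewrite !big_cons => <- {k}.
set k := (\sum_(b <- s) b)%N in IH * => xk.
have /IH : (k <= 4)%N by apply: leq_trans xk; exact: leq_addl.
move=> /(_ erefl); move: (\sum_(b <- s) (0 < b))%N => r.
move: (\sum_(b <- s) _)%N (\prod_(b <- s) _)%N => S D.
move: k xk {IH} => k xk rSD.
have chk : all (fun x => all (fun k => (x + k <= 4)%N ==>
     all (fun t => ((0 < x) + t.1.1, (9 ^ x).-1 %/ 8 + t.1.2, gauss_moment x.*2 * t.2)%N
            \in exponent_types (x + k))
       (exponent_types k)) (iota 0 5)) (iota 0 5) by vm_compute.
have xI : x \in iota 0 5.
  by rewrite mem_iota add0n ltnS; apply: leq_trans xk; exact: leq_addr.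
have kI : k \in iota 0 5.
  by rewrite mem_iota add0n ltnS; apply: leq_trans xk; exact: leq_addl.
by move/allP: chk => /(_ _ xI) /allP /(_ _ kI) /implyP /(_ xk) /allP /(_ _ rSD).
Qed.

Definition falling (F : pzRingType) (x : F) r := \prod_(i < r) (x - i%:R).

Lemma ffact_falling (F : pzRingType) k r : (k ^_ r)%:R = falling k%:R r :> F.
Proof.
rewrite /falling; elim: r => [|r IH]; first by rewrite big_ord0.
rewrite ffactnSr big_ord_recr /= natrM IH; have [rk|kr] := leqP r k.
  by rewrite natrB.
by rewrite -IH ffact_small // !mul0r.
Qed.

Section WeightIdentities.
Variables (F : realFieldType) (N M : F).
Hypotheses (N4 : 4 <= N) (M3 : 3 <= M) (MN : M + 1 <= N).

Lemma weights_moment8 t : t \in exponent_types 4 ->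
  weight_ones N M
  + weight_one N M * (falling 1 t.1.1 / falling N t.1.1)
  + weight_two N M * (falling 2 t.1.1 / falling N t.1.1)
  + weight_m N M * (falling M t.1.1 / falling N t.1.1)
  + weight_three N * ((8 * t.1.2%:R + N) / N) = t.2%:R / sphere_norm8 N.
Proof.
move: N4 M3 MN => N4' M3' MN'.
have n0 : N != 0 by apply/lt0r_neq0; lra.
have n1 : N - 1 != 0 by apply/lt0r_neq0; lra.
have n2 : N - 2 != 0 by apply/lt0r_neq0; lra.
have n3 : N - 3 != 0 by apply/lt0r_neq0; lra.
have p2 : N + 2 != 0 by apply/lt0r_neq0; lra.
have p4 : N + 4 != 0 by apply/lt0r_neq0; lra.
have p6 : N + 6 != 0 by apply/lt0r_neq0; lra.
have m0 : M != 0 by apply/lt0r_neq0; lra.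
have m1 : M - 1 != 0 by apply/lt0r_neq0; lra.
have m2 : M - 2 != 0 by apply/lt0r_neq0; lra.
have nm : N - M != 0 by apply/lt0r_neq0; lra.
rewrite /= !inE => /or4P[/eqP->|/eqP->|/eqP->|/orP[/eqP->|/eqP->]] /=;
  rewrite /weight_one /weight_two /weight_three /weight_ones /weight_m
    /num_one /num_two /num_ones /falling /sphere_norm8 !big_ord_recl !big_ord0 /= /bump /=.
all: field.
all: by rewrite ?n0 ?n1 ?n2 ?n3 ?p2 ?p4 ?p6 ?m0 ?m1 ?m2 ?nm.
Qed.

Lemma weights_sum :
  N ^+ 4 * weight_ones N M + 1%:R ^+ 4 * weight_one N M + 2%:R ^+ 4 * weight_two N M
  + M ^+ 4 * weight_m N M + (N + 8) ^+ 4 * weight_three N = 1.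
Proof.
move: N4 M3 MN => N4' M3' MN'.
have n0 : N != 0 by apply/lt0r_neq0; lra.
have p2 : N + 2 != 0 by apply/lt0r_neq0; lra.
have p4 : N + 4 != 0 by apply/lt0r_neq0; lra.
have p6 : N + 6 != 0 by apply/lt0r_neq0; lra.
have m0 : M != 0 by apply/lt0r_neq0; lra.
have m1 : M - 1 != 0 by apply/lt0r_neq0; lra.
have m2 : M - 2 != 0 by apply/lt0r_neq0; lra.
have nm : N - M != 0 by apply/lt0r_neq0; lra.
rewrite /weight_one /weight_two /weight_three /weight_ones /weight_m
  /num_one /num_two /num_ones /sphere_norm8.
field.
by rewrite ?n0 ?p2 ?p4 ?p6 ?m0 ?m1 ?m2 ?nm.
Qed.

End WeightIdentities.

Lemma admissible_pair_case (P : nat -> nat -> Prop) d m : admissible_pair d m ->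
  ((P 3 3 /\ P 4 3 /\ P 5 3 /\ P 6 3)
   /\ (P 7 4 /\ P 8 4 /\ P 9 4 /\ P 10 4)
   /\ (P 11 5 /\ P 12 5 /\ P 13 5 /\ P 14 5)
   /\ (P 15 6 /\ P 16 6 /\ P 17 6 /\ P 18 6)
   /\ (P 19 7 /\ P 20 7 /\ P 21 7 /\ P 22 7)
   /\ (P 23 8 /\ P 24 8 /\ P 25 8 /\ P 26 8))%N ->
  P d m.
Proof.
have split4 c a : (m == c) && (a <= d <= a + 3)%N ->
    P a c /\ P a.+1 c /\ P a.+2 c /\ P a.+3 c -> P d m.
  move=> /andP[/eqP -> ad] [P0 [P1 [P2 P3]]].
  by have /or4P[/eqP->|/eqP->|/eqP->|/eqP->] :
    [|| d == a, d == a.+1, d == a.+2 | d == a.+3] by lia.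
rewrite /admissible_pair => dm [P3 [P7 [P11 [P15 [P19 P23]]]]].
case/or4P: dm => [dm|dm|dm|/or3P[dm|dm|dm]]; by apply: (split4 _ _ dm).
Qed.

Lemma weight_nums_ge0 d m : admissible_pair d m ->
  [/\ 0 <= num_ones d.+1%:R m%:R :> rat, 0 <= num_two d.+1%:R m%:R :> rat,
      0 <= num_one d.+1%:R m%:R :> rat, 3 <= m%:R :> rat
    & m%:R + 1 <= d.+1%:R :> rat].
Proof.
move=> dm; pattern d, m; apply: (admissible_pair_case dm); cbv beta.
rewrite /num_one /num_two /num_ones.
repeat match goal with |- _ /\ _ => split end.
all: split; lra.
Qed.

Lemma weights_ge0 (F : realFieldType) (N M : F) : 3 <= M -> M + 1 <= N ->
  0 <= num_ones N M -> 0 <= num_two N M -> 0 <= num_one N M ->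
  [/\ 0 <= weight_ones N M, 0 <= weight_one N M,
      0 <= weight_two N M, 0 <= weight_m N M & 0 <= weight_three N].
Proof.
move=> M3 MN q1 q2 q3.
have K0 : 0 <= sphere_norm8 N by rewrite /sphere_norm8; do ![apply: mulr_ge0]; lra.
split; rewrite ?invr_ge0; try apply: divr_ge0; do ?[apply: mulr_ge0].
all: try assumption.
all: lra.
Qed.

(** * Sums of eighth powers *)

Section PowerSumCoefficients.
Variables (n : nat) (F : fieldType).
Implicit Types (a : mpoly.multinom n) (y : 'I_n -> F).

Lemma mcoeff_mulX (p : mpoly.mpoly n F) m a :
  mpoly.mcoeff a (p * mpoly.mpolyX F m) =
  if [forall i, m i <= a i]%N then mpoly.mcoeff (mpoly.mnm_sub a m) p else 0.
Proof.
have [/forallP le_ma | /forallPn[i]] := boolP [forall i, m i <= a i]%N.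
  rewrite -[in LHS](mpoly.submK (introT mpoly.mnm_lepP le_ma)).
  by rewrite mpoly.addmC mpoly.mcoeffMX.
rewrite -ltnNge => lt_am; apply/eqP; rewrite mpoly.mcoeff_eq0.
rewrite (perm_mem (mpoly.msuppMX p m)); apply/negP => /mapP[b _ eq_a].
by move: lt_am; rewrite eq_a mpoly.mnmDE ltnNge leq_addr.
Qed.

Lemma mcoeff_power_sum e y k a : (0 < e)%N ->
  mpoly.mcoeff a ((\sum_i y i *: mpoly.mpolyX F (mpoly.mnm_muln (mpoly.mnm1 i) e)) ^+ k)
    * (\prod_i (a i %/ e)`!)%N%:R =
  if [forall i, e %| a i]%N && (mpoly.mdeg a == k * e)%N
  then k`!%:R * \prod_i y i ^+ (a i %/ e) else 0.
Proof.
move=> e0; elim: k a => [|k IH] a.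
  rewrite expr0 mul0n mpoly.mdeg_eq0 mpoly.mcoeff1.
  have [->|] := eqVneq a mpoly.mnm0; last by rewrite mul0r andbF.
  rewrite ifT; last by apply/andP; split=> //; apply/forallP => i; rewrite mpoly.mnm0E.
  by rewrite !big1 ?mulr1 // => i _; rewrite mpoly.mnm0E div0n.
pose u i := mpoly.mnm_muln (mpoly.mnm1 i) e : mpoly.multinom n.
have uE i j : u i j = ((i == j) * e)%N by rewrite mpoly.mulmnE mpoly.mnm1E.
have uP i : [forall j, u i j <= a j]%N = (e <= a i)%N.
  apply/forallP/idP => [/(_ i)|ea j]; first by rewrite uE eqxx mul1n.
  by rewrite uE; case: eqP => [<-|_]; rewrite ?mul1n ?mul0n.
rewrite exprSr mulr_sumr raddf_sum mulr_suml /=.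
pose ok := [forall i, e %| a i]%N && (mpoly.mdeg a == k.+1 * e)%N.
transitivity (\sum_i if ok then (a i %/ e)%:R * (k`!%:R * \prod_j y j ^+ (a j %/ e)) else 0).
  apply: eq_bigr => i _; rewrite -scalerAr mpoly.mcoeffZ mcoeff_mulX uP.
  have [ea|ltae] := leqP e (a i); last first.
    rewrite mulr0 mul0r divn_small // mul0r; by case: ifP.
  set b := mpoly.mnm_sub a (u i).
  have bi : (b i %/ e).+1 = (a i %/ e)%N.
    by rewrite /b mpoly.mnmBE uE eqxx mul1n -[in RHS](subnK ea) divnDr // divnn e0 addn1.
  have bj j : j != i -> b j = a j.
    by move=> ji; rewrite /b mpoly.mnmBE uE eq_sym (negPf ji) mul0n subn0.
  have ab : a = mpoly.mnm_add b (u i).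
    apply/mpoly.mnmP => j; rewrite mpoly.mnmDE mpoly.mnmBE subnK //.
    by move: j; apply/forallP; rewrite uP.
  have -> : (\prod_j (a j %/ e)`! = (a i %/ e) * \prod_j (b j %/ e)`!)%N.
    rewrite (bigD1 i) //= [in RHS](bigD1 i) //= -bi factS mulnA; congr (_ * _)%N.
    by apply: eq_bigr => j /bj ->.
  have -> : \prod_j y j ^+ (a j %/ e) = y i * \prod_j y j ^+ (b j %/ e).
    rewrite (bigD1 i) //= [in RHS](bigD1 i) //= -bi exprS mulrA; congr (_ * _).
    by apply: eq_bigr => j /bj ->.
  set P := (\prod_j (b j %/ e)`!)%N; set c := mpoly.mcoeff b _.
  have -> : y i * c * ((a i %/ e) * P)%:R = (a i %/ e)%:R * y i * (c * P%:R).
    by rewrite natrM; ring.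
  rewrite {}/c {}/P IH.
  have -> : [forall i, e %| b i]%N && (mpoly.mdeg b == k * e)%N = ok.
    rewrite /ok; congr (_ && _).
      apply/forallP/forallP => H j; move: (H j).
        by rewrite ab mpoly.mnmDE uE => ?; rewrite dvdn_add // dvdn_mull.
      by rewrite [in X in X -> _]ab mpoly.mnmDE uE dvdn_addl // dvdn_mull.
    by rewrite [in RHS]ab mpoly.mdegD mpoly.mdegMn mpoly.mdeg1 mul1n mulSn addnC eqn_add2l.
  by case: ok; [ring | rewrite mulr0].
rewrite -/ok; case okE: ok; last by rewrite big1.
rewrite -mulr_suml mulrA; congr (_ * _); rewrite -natr_sum.
have /andP[/forallP dv /eqP dg] : ok by rewrite okE.
have -> : (\sum_i a i %/ e = k.+1)%N.
  apply/eqP; rewrite -(eqn_pmul2r e0) -dg mpoly.mdegE big_distrl /=.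
  by apply/eqP/eq_bigr => i _; rewrite divnK.
by rewrite factS natrM.
Qed.

End PowerSumCoefficients.

Section Hilbert.
Variables (n : nat) (F : numFieldType).
Implicit Types (a : mpoly.multinom n) (y : 'I_n -> F).
Local Notation X i := (mpoly.mpolyX F (mpoly.mnm1 i)).
Local Notation lin y := (\sum_i y i *: X i).

Lemma prod_fact_double_gauss a : [forall i, 2 %| a i]%N ->
  (\prod_i (a i)`! =
     2 ^ (mpoly.mdeg a)./2 * (\prod_i (a i %/ 2)`!) * \prod_i gauss_moment (a i))%N.
Proof.
move/forallP => ev.
have aE i : a i = ((a i)./2).*2 by rewrite even_halfK // -dvdn2 ev.
have -> : (mpoly.mdeg a)./2 = (\sum_i (a i)./2)%N.
  rewrite mpoly.mdegE (eq_bigr (fun i => (a i)./2 * 2)%N) => [|i _]; last by rewrite muln2 -aE.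
  by rewrite -big_distrl /= muln2 doubleK.
rewrite expn_sum -!big_split /=; apply: eq_bigr => i _.
by rewrite [in LHS]aE fact_double_gauss -aE divn2.
Qed.

Lemma mcoeff_linear_form y k a :
  mpoly.mcoeff a ((lin y) ^+ k) * (\prod_i (a i)`!)%N%:R =
  if mpoly.mdeg a == k then k`!%:R * \prod_i y i ^+ a i else 0.
Proof.
have := mcoeff_power_sum y k a (ltn0Sn 0).
rewrite muln1 (eq_bigr (fun i => y i *: X i)) => [|i _]; last first.
  by congr (_ *: mpoly.mpolyX _ _); apply/mpoly.mnmP => j; rewrite mpoly.mulmnE muln1.
rewrite (eq_bigr (fun i => (a i)`!)) => [|i _]; last by rewrite divn1.
move=> ->.
rewrite (eq_bigr (fun i => y i ^+ a i)) => [|i _]; last by rewrite divn1.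
by rewrite (introT forallP) // => i; rewrite dvd1n.
Qed.

Lemma mcoeff_sum_squares k a :
  mpoly.mcoeff a ((\sum_i X i ^+ 2) ^+ k) * (\prod_i (a i %/ 2)`!)%N%:R =
  if [forall i, 2 %| a i]%N && (mpoly.mdeg a == k * 2)%N then k`!%:R else 0.
Proof.
have := mcoeff_power_sum (fun=> 1 : F) k a (ltn0Sn 1).
rewrite (eq_bigr (fun i => X i ^+ 2)) => [->|i _]; last first.
  by rewrite scale1r mpoly.mpolyXn.
by rewrite big1 ?mulr1 // => i _; rewrite expr1n.
Qed.

Lemma sum_linear_forms (s : seq (F * ('I_n -> F))) (C : F) :
  (forall a, mpoly.mdeg a = 8%N ->
     \sum_(q <- s) q.1 * signed_mean q.2 a = (\prod_i gauss_moment (a i))%N%:R * C) ->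
  \sum_(q <- s) \sum_(p : {ffun 'I_n -> bool} * 'S_n)
    (q.1 / #|{: {ffun 'I_n -> bool} * 'S_n}|%:R)
      *: (lin (fun i => (-1) ^+ p.1 i * q.2 (p.2 i))) ^+ 8
  = (105 * C) *: (\sum_i X i ^+ 2) ^+ 4.
Proof.
move=> moments; apply/mpoly.mpolyP => a.
have fact_neq0 (f : 'I_n -> nat) : (\prod_i (f i)`!)%N%:R != 0 :> F.
  by rewrite pnatr_eq0 -lt0n prodn_gt0 // => i; rewrite fact_gt0.
apply: (mulIf (fact_neq0 a)); rewrite mpoly.mcoeffZ.
rewrite raddf_sum mulr_suml /=.
transitivity (if mpoly.mdeg a == 8%N
              then 8`!%:R * \sum_(q <- s) q.1 * signed_mean q.2 a else 0).
  transitivity (\sum_(q <- s) if mpoly.mdeg a == 8%N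
                 then 8`!%:R * (q.1 * signed_mean q.2 a) else 0); last first.
    by case: ifP => _; [rewrite -mulr_sumr | rewrite big1_eq].
  apply: eq_bigr => q _; rewrite raddf_sum mulr_suml /=.
  under eq_bigr => p _ do rewrite mpoly.mcoeffZ -mulrA mcoeff_linear_form.
  case: ifP => _; last by rewrite big1 // => p _; rewrite mulr0.
  rewrite -mulr_sumr -mulr_sumr /signed_mean; field.
  by rewrite pnatr_eq0 -lt0n; apply/card_gt0P; exists ([ffun=> false], 1%g).
have := mcoeff_sum_squares 4 a; rewrite (_ : 4 * 2 = 8)%N //.
set c := mpoly.mcoeff a _.
have [/[dup] ev /prod_fact_double_gauss ->|] := boolP [forall i, 2 %| a i]%N.
  case: (eqVneq (mpoly.mdeg a) 8%N) => [a8|_] /= E; last first.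
    by move/eqP: E; rewrite mulf_eq0 (negPf (fact_neq0 _)) orbF => /eqP ->; rewrite mulr0 mul0r.
  rewrite moments // a8 (_ : 8`! = 105 * (2 ^ 4 * 4`!))%N; last first.
    by rewrite 4!factS (_ : 2 ^ 4 = 16)%N //; move: (4`!)%N => t; lia.
  rewrite (_ : 8./2 = 4)%N //; move: E; move: (4`!)%N (2 ^ 4)%N => u v E.
  by rewrite !natrM -E; ring.
rewrite negb_forall => /existsP[i odd_ai] /= /eqP.
rewrite mulf_eq0 (negPf (fact_neq0 _)) orbF => /eqP ->; rewrite mulr0 mul0r.
case: eqP => // a8; rewrite moments // (bigD1 i) //= gauss_moment_odd ?mul0n ?mul0r ?mulr0 //.
by move: odd_ai; rewrite dvdn2 negbK.
Qed.

Lemma positive_combination (s : seq (F * ('I_n -> F))) :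
  all (fun q : F * ('I_n -> F) => 0 <= q.1) s ->
  exists (N : nat) (c : 'I_N -> F) (b : 'I_N -> 'I_n -> F),
    (forall k, 0 < c k) /\
    \sum_(q <- s) q.1 *: (lin q.2) ^+ 8 = \sum_(k < N) c k *: (lin (b k)) ^+ 8.
Proof.
elim: s => [_|[c y] s IH /= /andP[]].
  by exists 0%N, (fun=> 0), (fun=> fun=> 0); split=> [[]|]; rewrite // big_nil big_ord0.
rewrite le_eqVlt => /orP[/eqP c0|c0] /IH[N [c' [b' [c'0 E]]]].
  by exists N, c', b'; split=> //; rewrite big_cons -E -c0 scale0r add0r.
exists N.+1, (fun k => if unlift ord0 k is Some j then c' j else c),
  (fun k => if unlift ord0 k is Some j then b' j else y); split.
  by move=> k; case: unliftP.
rewrite big_cons big_ord_recl unlift_none E; apply: congr1.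
by apply: eq_bigr => k _; rewrite liftK.
Qed.

End Hilbert.

Section Rule.
Variables (n : nat) (F : realFieldType).

Definition ones k : 'I_n -> F := fun i => (i < k)%N%:R.

Definition three_ones : 'I_n -> F := fun i => if i == 0%N :> nat then 3 else 1.

Definition weighted_nodes (m : nat) : seq (F * ('I_n -> F)) :=
  [:: (weight_ones n%:R m%:R, ones n); (weight_one n%:R m%:R, ones 1);
      (weight_two n%:R m%:R, ones 2); (weight_m n%:R m%:R, ones m);
      (weight_three n%:R, three_ones)].

Lemma weighted_nodes_moment8 m a : 4 <= n%:R :> F -> 3 <= m%:R :> F ->
  m%:R + 1 <= n%:R :> F -> mpoly.mdeg a = 8%N ->
  \sum_(q <- weighted_nodes m) q.1 * signed_mean q.2 a =
    (\prod_i gauss_moment (a i))%N%:R / sphere_norm8 n%:R.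
Proof.
move=> n4 m3 mn a8.
have [/forallP ev|] := boolP [forall i, ~~ odd (a i)]; last first.
  rewrite negb_forall => /existsP[i]; rewrite negbK => ai.
  rewrite (bigD1 i) //= gauss_moment_odd // mul0n mul0r big1 // => q _.
  by rewrite (signed_mean_odd _ ai) mulr0.
have hn4 : (4 <= n)%N by rewrite -(ler_nat F).
have hmn : (m <= n)%N by rewrite -(ler_nat F); lra.
have half i : a i = ((a i)./2).*2 by rewrite even_halfK.
set r := #|[set i | (0 < a i)%N]%SET|.
pose S := (\sum_i (9 ^ (a i)./2).-1 %/ 8)%N.
pose D := (\prod_i gauss_moment (a i))%N.
have rSD : (r, S, D) \in exponent_types 4.
  have sum4 : (\sum_(b <- [seq (a i)./2 | i <- index_enum 'I_n]) b = 4)%N.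
    apply: double_inj; rewrite big_map -[RHS]a8 mpoly.mdegE -muln2 big_distrl /=.
    by apply: eq_bigr => i _; rewrite muln2 -half.
  have rE : (\sum_i (0 < (a i)./2) = r)%N.
    rewrite /r -sum1_card [RHS]big_mkcond; apply: eq_bigr => i _.
    by rewrite inE [in RHS]half double_gt0; case: (0 < _)%N.
  have DE : (\prod_i gauss_moment (a i)./2.*2 = D)%N.
    by apply: eq_bigr => i _; rewrite -half.
  by have := exponent_typesP sum4 (leqnn 4); rewrite !big_map rE DE.
have three_sum : (\sum_i 3 ^ a i = 8 * S + n)%N.
  rewrite /S big_distrr /= -[X in (_ + X)%N]card_ord -sum1_card -big_split /=.
  apply: eq_bigr => i _; rewrite [in LHS]half -mul2n expnM.
  rewrite mulnC divnK; first by rewrite addn1 prednK ?expn_gt0.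
  by rewrite predn_exp dvdn_mulr.
have one k : (k <= n)%N ->
    signed_mean (ones k) a = falling k%:R r / falling n%:R r :> F.
  by move=> kn; rewrite /ones signed_mean_ones // !ffact_falling.
have fn0 : falling n%:R r != 0 :> F.
  rewrite -ffact_falling pnatr_eq0 -lt0n ffact_gt0.
  by rewrite -[X in (_ <= X)%N](card_ord n) max_card.
rewrite /weighted_nodes !big_cons big_nil /= addr0 !addrA !one //; try lia.
rewrite divff // mulr1 signed_mean_three //; try lia.
by rewrite three_sum natrD natrM (weights_moment8 n4 m3 mn rSD).
Qed.

Lemma sum_squares_pow4 m : 4 <= n%:R :> F -> 3 <= m%:R :> F ->
  m%:R + 1 <= n%:R :> F ->
  [/\ 0 <= weight_ones n%:R m%:R :> F, 0 <= weight_one n%:R m%:R :> F,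
      0 <= weight_two n%:R m%:R :> F, 0 <= weight_m n%:R m%:R :> F
    & 0 <= weight_three n%:R :> F] ->
  exists (N : nat) (c : 'I_N -> F) (b : 'I_N -> 'I_n -> F),
    (forall k, 0 < c k) /\
    (\sum_(i < n) mpoly.mpolyX F (mpoly.mnm1 i) ^+ 2) ^+ 4 =
      \sum_(k < N) c k *: (\sum_(i < n) b k i *: mpoly.mpolyX F (mpoly.mnm1 i)) ^+ 8.
Proof.
move=> n4 m3 mn [w1 w2 w3 w4 w5].
have w0 : all (fun q : F * ('I_n -> F) => 0 <= q.1) (weighted_nodes m).
  by rewrite /= w1 w2 w3 w4 w5.
have K0 : 0 < sphere_norm8 n%:R :> F.
  by rewrite /sphere_norm8; do ![apply: mulr_gt0]; lra.
have E := sum_linear_forms (fun a => weighted_nodes_moment8 n4 m3 mn (a := a)).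
pose K := 105 * (sphere_norm8 n%:R)^-1 : F.
pose G := #|{: {ffun 'I_n -> bool} * 'S_n}|%:R : F.
have Kgt0 : 0 < K by rewrite /K mulr_gt0 // invr_gt0.
pose s := [seq (q.1 / G / K, (fun i => (-1) ^+ p.1 i * q.2 (p.2 i)))
  | q : F * ('I_n -> F) <- weighted_nodes m,
      p : {ffun 'I_n -> bool} * 'S_n <- index_enum {: {ffun 'I_n -> bool} * 'S_n}].
have s0 : all (fun q : F * ('I_n -> F) => 0 <= q.1) s.
  rewrite /s; elim: (weighted_nodes m) w0 => //= q w IH /andP[q0 /IH w0].
  rewrite all_cat w0 andbT all_map; apply/allP => p _ /=.
  by apply: divr_ge0 (ltW Kgt0); apply: divr_ge0 => //; rewrite /G ler0n.
have [N [c [b [c0 Es]]]] := positive_combination s0.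
have unscale (v : mpoly.mpoly n F) : v = K^-1 *: (K *: v).
  by rewrite scalerA mulVf ?scale1r ?lt0r_neq0.
exists N, c, b; split=> //; rewrite -Es /s big_allpairs_dep /=.
rewrite [LHS]unscale -E scaler_sumr.
apply: eq_bigr => q _; rewrite scaler_sumr; apply: eq_bigr => p _.
by rewrite scalerA mulrC.
Qed.

End Rule.

(** * Orbit means and the sphere integral *)

Section OrbitMean.
Variables (R : realType) (n : nat).
Implicit Types (x y : n.-tuple R).

Local Notation T := ({ffun 'I_n -> bool} * 'S_n)%type.

Local Notation act p x := (signed_perm p.1 p.2 x).

Definition signed_perm_mul (p q : T) : T :=
  ([ffun i => p.1 i (+) q.1 (p.2 i)], (p.2 * q.2)%g).

Lemma signed_perm_mulE (p q : T) x : act (signed_perm_mul p q) x = act p (act q x).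
Proof.
apply: eq_from_tnth => i; rewrite !tnth_mktuple ffunE permM.
by rewrite signr_addb mulrA.
Qed.

Lemma signed_perm_mul_inj (p : T) : injective (signed_perm_mul p).
Proof.
move=> [e s] [e' s'] [/ffunP ee' /mulgI ->]; congr (_, _); apply/ffunP => i.
by have := ee' ((p.2)^-1%g i); rewrite !ffunE permKV => /addbI.
Qed.

Lemma signed_perm_inj (p : T) : injective (fun x => act p x).
Proof.
move=> x y /(congr1 (fun z => tnth z)) xy; apply: eq_from_tnth => i.
have := congr1 (fun f => f ((p.2)^-1%g i)) xy; rewrite !tnth_mktuple permKV.
by move/mulfI; apply; rewrite signr_eq0.
Qed.

Lemma orbit_meanE (f : n.-tuple R -> R) y :
  orbit_mean f y =
    (\sum_(p : T) f (act p y)) / #|{: T}|%:R.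
Proof.
set s := [seq act p y | p : T].
pose c := #|[pred p : T | act p y == y]|.
have c_gt0 : (0 < c)%N.
  apply/card_gt0P; exists ([ffun=> false], 1%g); rewrite inE; apply/eqP.
  by apply: eq_from_tnth => i; rewrite tnth_mktuple ffunE perm1 mul1r.
have count_s z : z \in s -> count_mem z s = c.
  move=> /mapP[p0 _ ->]; rewrite /s count_map -sum1_count.
  rewrite big_enum_cond /c -sum1_card /=.
  rewrite (reindex_inj (@signed_perm_mul_inj p0)); apply: eq_bigl => p.
  by rewrite !inE /= signed_perm_mulE (inj_eq (@signed_perm_inj p0)).
have sum_s (g : n.-tuple R -> R) : \sum_(z <- s) g z = c%:R * \sum_(z <- undup s) g z.
  rewrite -big_undup_iterop_count big_distrr /=; apply: eq_big_seq => z.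
  by rewrite mem_undup => /count_s ->; rewrite Monoid.iteropE iter_addr_0 mulr_natl.
have sum1 (t : seq (n.-tuple R)) : \sum_(z <- t) 1 = (size t)%:R :> R.
  by rewrite big_const_seq count_predT iter_addr_0.
have card_s : #|{: T}|%:R = c%:R * (size (undup s))%:R :> R.
  by rewrite -sum1 -sum_s sum1 size_image.
have <- : \sum_(z <- s) f z = \sum_(p : T) f (act p y).
  by rewrite /s big_map big_enum.
have c0 : c%:R != 0 :> R by rewrite pnatr_eq0 -lt0n.
by rewrite sum_s card_s invfM mulrACA divff // mul1r.
Qed.

Lemma orbit_mean_monomial y a :
  orbit_mean (poly_fun (mpoly.mpolyX R a)) y = signed_mean (tnth y) a.
Proof.
rewrite orbit_meanE /signed_mean; congr (_ / _); apply: eq_bigr => p _.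
rewrite /poly_fun mpoly.mevalX; apply: eq_bigr => i _.
by rewrite tnth_mktuple.
Qed.

Lemma poly_fun_expand (f : mpoly.mpoly n R) x :
  poly_fun f x = \sum_(a <- mpoly.msupp f) mpoly.mcoeff a f * poly_fun (mpoly.mpolyX R a) x.
Proof.
rewrite /poly_fun mpoly.mevalE; apply: eq_bigr => a _.
by rewrite mpoly.mevalX.
Qed.

Lemma orbit_mean_expand (f : mpoly.mpoly n R) y :
  orbit_mean (poly_fun f) y =
    \sum_(a <- mpoly.msupp f) mpoly.mcoeff a f * signed_mean (tnth y) a.
Proof.
under [RHS]eq_bigr => a _ do rewrite -orbit_mean_monomial orbit_meanE mulrA.
rewrite orbit_meanE -mulr_suml; congr (_ / _).
under eq_bigr => p _ do rewrite poly_fun_expand.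
by rewrite exchange_big /=; apply: eq_bigr => a _; rewrite mulr_sumr.
Qed.

End OrbitMean.

Section Givens.
Variables (R : realType) (n : nat) (i j : 'I_n).
Hypothesis ij : i != j.

Definition givens (c s : R) : 'M[R]_n :=
  \matrix_(k, l) if k == i then c * (l == i)%:R - s * (l == j)%:R
                 else if k == j then s * (l == i)%:R + c * (l == j)%:R
                 else (l == k)%:R.

Lemma sum_givens c s k (v : 'I_n -> R) :
  \sum_l givens c s k l * v l =
    if k == i then c * v i - s * v j
    else if k == j then s * v i + c * v j else v k.
Proof.
have delta (w : 'I_n -> R) h : \sum_l (l == h)%:R * w l = w h.
  rewrite (bigD1 h) //= eqxx mul1r big1 ?addr0 // => l /negPf ->.
  by rewrite mul0r.
under eq_bigr => l _ do rewrite mxE.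
case: ifP => _; last case: ifP => _; last exact: delta.
- under eq_bigr => l _ do rewrite mulrBl -!mulrA.
  by rewrite sumrB -!mulr_sumr !delta.
- under eq_bigr => l _ do rewrite mulrDl -!mulrA.
  by rewrite big_split /= -!mulr_sumr !delta.
Qed.

Lemma givens_mul c s c' s' :
  givens c s *m givens c' s' = givens (c * c' - s * s') (s * c' + c * s').
Proof.
have ji : (j == i) = false by rewrite eq_sym (negPf ij).
apply/matrixP => k l; rewrite !mxE sum_givens !mxE eqxx ji eqxx.
by case: (k == i); [ring | case: (k == j); [ring | by []]].
Qed.

Lemma givens_tr c s : (givens c s)^T = givens c (- s).
Proof.
have ji : (j == i) = false by rewrite eq_sym (negPf ij).
apply/matrixP => k l; rewrite !mxE.
rewrite [k == l]eq_sym; case: (eqVneq k i) => [->|ki].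
  rewrite (negPf ij); case: (eqVneq l i) => [->|li]; last by case: (l == j); rewrite /=; ring.
  by rewrite (negPf ij); rewrite /=; ring.
case: (eqVneq k j) => [->|kj].
  case: (eqVneq l i) => [->|li]; last by case: (l == j); rewrite /=; ring.
  by rewrite (negPf ij); rewrite /=; ring.
case: (eqVneq l i) => [->|li]; first by rewrite eq_sym (negPf ki); rewrite /=; ring.
case: (eqVneq l j) => [->|lj] //.
by rewrite [j == k]eq_sym (negPf kj); rewrite /=; ring.
Qed.

Lemma givens_id : givens 1 0 = 1%:M.
Proof.
apply/matrixP => k l; rewrite !mxE [k == l]eq_sym.
case: eqP => [->|_]; first by rewrite /=; ring.
by case: eqP => [->|_]; rewrite // mul0r mul1r add0r.
Qed.

(* The rotation with rational parameter t is the square of the orthogonal matrix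
   of half its angle, hence has determinant 1. *)
Lemma givens_rotation (t : R) :
  is_rotation (givens ((1 - t ^+ 2) / (1 + t ^+ 2)) (2 * t / (1 + t ^+ 2))).
Proof.
have t1 : 0 < 1 + t ^+ 2 by rewrite ltr_pwDl // sqr_ge0.
have t0 := lt0r_neq0 t1.
pose r := (Num.sqrt (1 + t ^+ 2))^-1.
have r2 : r * r = (1 + t ^+ 2)^-1.
  by rewrite /r -invfM -expr2 sqr_sqrtr // ltW.
have half : givens ((1 - t ^+ 2) / (1 + t ^+ 2)) (2 * t / (1 + t ^+ 2)) =
            givens r (t * r) *m givens r (t * r).
  by rewrite givens_mul; congr givens; rewrite -?r2; ring.
have orth : givens r (t * r) *m (givens r (t * r))^T = 1%:M.
  rewrite givens_tr givens_mul -givens_id; congr givens; last by ring.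
  rewrite (_ : _ - _ = (1 + t ^+ 2) * (r * r)); last by ring.
  by rewrite r2 mulfV.
rewrite half; split; last first.
  have := congr1 determinant orth.
  by rewrite det_mulmx det_tr det1 -det_mulmx.
by rewrite trmx_mul mulmxA -(mulmxA (givens r (t * r)) (givens r (t * r))) orth mulmx1.
Qed.

End Givens.

Section SphereIntegral.
Variables (R : realType) (n : nat) (sigma : probability (n.-tuple R) R).
Hypothesis sigma_uniform : is_uniform_on_sphere sigma.
Implicit Types (f g : mpoly.mpoly n R) (x y : n.-tuple R).

Local Notation S := (@unit_sphere R n).

Lemma measurable_poly_fun f : measurable_fun [set: n.-tuple R] (poly_fun f).
Proof.
rewrite (_ : poly_fun f = fun x => \sum_(a <- mpoly.msupp f)
    mpoly.mcoeff a f * \prod_i tnth x i ^+ a i); last first.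
  by apply/funext => x; rewrite /poly_fun mpoly.mevalE.
apply: measurable_sum => a; apply: measurable_funM; first exact: measurable_cst.
apply: measurable_prod => i _; apply: measurable_funX; exact: measurable_tnth.
Qed.

Lemma measurable_unit_sphere : measurable S.
Proof.
have -> : S = (fun x => \sum_(i < n) tnth x i ^+ 2) @^-1` [set 1] by [].
rewrite -[X in measurable X]setTI; apply: measurable_sum => // i.
apply: measurable_funX; exact: measurable_tnth.
Qed.

Lemma measurable_linear_map (Q : 'M[R]_n) :
  measurable_fun [set: n.-tuple R] (linear_map Q).
Proof.
apply/measurable_fun_tnthP => i.
rewrite (_ : _ \o _ = fun x => \sum_j Q i j * tnth x j); last first.
  by apply/funext => x /=; rewrite tnth_mktuple.
apply: measurable_sum => j; apply: measurable_funM; first exact: measurable_cst.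
exact: measurable_tnth.
Qed.

Lemma poly_fun_bounded f x : S x ->
  `|poly_fun f x| <= \sum_(a <- mpoly.msupp f) `|mpoly.mcoeff a f|.
Proof.
move=> Sx; have x1 i : `|tnth x i| <= 1.
  rewrite -[leRHS](@sqrtr1 R) -sqrtr_sqr ler_wsqrtr // -Sx (bigD1 i) //= lerDl.
  by apply: sumr_ge0 => j _; exact: sqr_ge0.
rewrite /poly_fun mpoly.mevalE; apply: le_trans (ler_norm_sum _ _ _) _.
apply: ler_sum => a _; rewrite normrM ler_piMr // normr_prod prodr_ile1 // => i _.
by rewrite normrX exprn_ge0 //= exprn_ile1.
Qed.

Lemma integrable_poly_fun f : sigma.-integrable S (EFin \o poly_fun f).
Proof.
apply: measurable_bounded_integrable; first exact: measurable_unit_sphere.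
- by apply: le_lt_trans (probability_le1 sigma measurable_unit_sphere) _; rewrite ltry.
- exact: measurable_funTS (measurable_poly_fun f).
- exists (\sum_(a <- mpoly.msupp f) `|mpoly.mcoeff a f|); split; first exact: num_real.
  by move=> M ltM x Sx; exact: le_trans (poly_fun_bounded f Sx) (ltW ltM).
Qed.

Definition sphere_integral f : R := \int[sigma]_(x in S) poly_fun f x.
Local Notation L := sphere_integral.

Lemma sphere_integralE f :
  (\int[sigma]_(x in S) (poly_fun f x)%:E)%E = (L f)%:E.
Proof.
rewrite /L /Rintegral fineK //.
by apply: integrable_fin_num (integrable_poly_fun f); exact: measurable_unit_sphere.
Qed.

Lemma sphere_integralD f g : L (f + g) = L f + L g.
Proof.
rewrite /L -RintegralD; first by congr Rintegral; apply/funext => x; rewrite /poly_fun mpoly.mevalD.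
- exact: measurable_unit_sphere.
- exact: integrable_poly_fun.
- exact: integrable_poly_fun.
Qed.

Lemma sphere_integralZ c f : L (c *: f) = c * L f.
Proof.
rewrite /L -RintegralZl; first by congr Rintegral; apply/funext => x; rewrite /poly_fun mpoly.mevalZ.
- exact: measurable_unit_sphere.
- exact: integrable_poly_fun.
Qed.

Lemma sphere_integral0 : L 0 = 0.
Proof. by rewrite -[0 in LHS](scale0r 0) sphere_integralZ mul0r. Qed.

Lemma sphere_integral_sum (I : Type) (r : seq I) (h : I -> mpoly.mpoly n R) :
  L (\sum_(k <- r) h k) = \sum_(k <- r) L (h k).
Proof. exact: (big_morph _ sphere_integralD sphere_integral0). Qed.

Lemma sphere_integral1 : L 1 = 1.
Proof.
rewrite /L (_ : poly_fun 1 = cst 1); last by apply/funext => x; rewrite /poly_fun mpoly.meval1.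
rewrite Rintegral_cst; last exact: measurable_unit_sphere.
by rewrite mul1r; apply: (congr1 fine sigma_uniform.1).
Qed.

Lemma eq_sphere_integral f g :
  (forall x, S x -> poly_fun f x = poly_fun g x) -> L f = L g.
Proof. by move=> fg; apply: eq_Rintegral => x /set_mem; exact: fg. Qed.

Lemma linear_map_sphere (Q : 'M[R]_n) x :
  is_rotation Q -> S (linear_map Q x) <-> S x.
Proof.
move=> [QQ _]; rewrite /unit_sphere /=.
suff -> : \sum_i tnth (linear_map Q x) i ^+ 2 = \sum_i tnth x i ^+ 2 by [].
pose v : 'cV[R]_n := \col_i tnth x i.
have normE (w : 'cV[R]_n) : \sum_i w i ord0 ^+ 2 = (w^T *m w) ord0 ord0.
  by rewrite mxE; apply: eq_bigr => i _; rewrite mxE expr2.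
have := normE v; under eq_bigr => i _ do rewrite mxE; move=> ->.
have := normE (Q *m v); rewrite trmx_mul mulmxA -(mulmxA v^T) (mulmx1C QQ) mulmx1 => <-.
apply: eq_bigr => i _; rewrite tnth_mktuple mxE.
by under [in RHS]eq_bigr => j _ do rewrite mxE.
Qed.

Lemma sphere_integral_rotation (Q : 'M[R]_n) f g : is_rotation Q ->
  (forall x, poly_fun g x = poly_fun f (linear_map Q x)) -> L g = L f.
Proof.
move=> Qrot gE.
have mQ := measurable_linear_map Q.
have SQ : linear_map Q @^-1` S = S.
  by apply/seteqP; split=> x /= /(linear_map_sphere x Qrot).
rewrite /L /Rintegral; congr fine.
transitivity (\int[pushforward sigma (linear_map Q)]_(x in S) (poly_fun f x)%:E)%E.
  rewrite (@integral_pushforward _ _ _ _ _ _ mQ sigma S (EFin \o poly_fun f)).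
  - by rewrite SQ; apply: eq_integral => x _; rewrite /= gE.
  - by apply/measurable_EFinP; exact: measurable_poly_fun.
  - rewrite SQ; have -> : (EFin \o poly_fun f) \o linear_map Q = EFin \o poly_fun g.
      by apply/funext => x; rewrite /= gE.
    exact: integrable_poly_fun.
  - exact: measurable_unit_sphere.
apply: eq_measure_integral => A mA _.
exact: sigma_uniform.2.
Qed.

End SphereIntegral.

Lemma eq_poly_horner (F : numFieldType) (p q : {poly F}) :
  (forall t, p.[t] = q.[t]) -> p = q.
Proof.
move=> pq; apply/eqP; rewrite -subr_eq0; apply/eqP.
apply: (@roots_geq_poly_eq0 _ _ [seq k%:R | k <- iota 0 (size (p - q))]).
- by apply/allP => t _; rewrite /root hornerD hornerN pq subrr.
- by rewrite map_inj_uniq ?iota_uniq // => k l /eqP; rewrite eqr_nat => /eqP.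
- by rewrite size_map size_iota.
Qed.

Section RotatedMonomial.
Variable A : comNzRingType.
Implicit Types (u v w t : A).

(* [u ^ p * v ^ q * w] after the rotation of the (u, v)-plane of parameter 'X,
   the denominators 1 + 'X^2 being cleared. *)
Definition rotated_monomial u v w p q : {poly A} :=
  ((1 - 'X^2) * u%:P - 'X * (2 * v)%:P) ^+ p
  * ('X * (2 * u)%:P + (1 - 'X^2) * v%:P) ^+ q * w%:P.

Lemma horner_rotated_monomial u v w p q t :
  (rotated_monomial u v w p q).[t] =
    ((1 - t ^+ 2) * u - t * (2 * v)) ^+ p
    * (t * (2 * u) + (1 - t ^+ 2) * v) ^+ q * w.
Proof. by rewrite /rotated_monomial !hornerE. Qed.

Lemma coef1_deriv (r : {poly A}) : r`_1 = r^`().[0].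
Proof. by rewrite horner_coef0 coef_deriv. Qed.

Lemma coef1_rotated_monomial u v w p q :
  (rotated_monomial u v w p q)`_1 =
    (u ^+ p.+1 * v ^+ q.-1 * w) *+ (2 * q) - (u ^+ p.-1 * v ^+ q.+1 * w) *+ (2 * p).
Proof.
rewrite coef1_deriv /rotated_monomial !derivM !deriv_exp !poly.derivE !hornerE.
rewrite !hornerMn !hornerE expr0n /= !(addr0, add0r, subr0, mul1r, oppr0, mul0r).
rewrite !exprS.
move: (u ^+ p) (v ^+ q) (u ^+ p.-1) (v ^+ q.-1) => up vq up' vq'.
ring.
Qed.

End RotatedMonomial.

Section SphereMoments.
Variables (R : realType) (n : nat) (sigma : probability (n.-tuple R) R).
Hypothesis sigma_uniform : is_uniform_on_sphere sigma.
Implicit Types (f g : mpoly.mpoly n R) (a : mpoly.multinom n).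

Local Notation L := (sphere_integral sigma).
Local Notation X i := (mpoly.mpolyX R (mpoly.mnm1 i)).

(* Compares the coefficients of t in an identity of polynomials: the
   integral of X_i^p X_j^q g after the rotation of parameter t, multiplied by
   (1 + t^2)^(p + q), is (1 + t^2)^(p + q) times the integral before it. *)
Lemma sphere_integral_deriv i j g p q : i != j ->
  (forall x y : n.-tuple R, (forall k, k != i -> k != j -> tnth x k = tnth y k) ->
     poly_fun g x = poly_fun g y) ->
  q%:R * L (X i ^+ p.+1 * X j ^+ q.-1 * g) =
  p%:R * L (X i ^+ p.-1 * X j ^+ q.+1 * g).
Proof.
move=> ij g_indep.
pose G := rotated_monomial (X i) (X j) g p q.
pose f := X i ^+ p * X j ^+ q * g.
pose P : {poly R} := \poly_(k < size G) L G`_k.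
have PE t : P.[t] = L G.[mpoly.mpolyC n t].
  rewrite horner_poly horner_coef sphere_integral_sum //; apply: eq_bigr => k _.
  by rewrite -rmorphXn [G`_k * _]mulrC mpoly.mul_mpolyC sphere_integralZ mulrC.
have GE t : L G.[mpoly.mpolyC n t] = (1 + t ^+ 2) ^+ (p + q) * L f.
  have t0 : 1 + t ^+ 2 != 0 by rewrite lt0r_neq0 // ltr_pwDl // sqr_ge0.
  rewrite -sphere_integralZ.
  apply: (sphere_integral_rotation sigma_uniform (givens_rotation ij t)) => x.
  set y := linear_map _ x.
  have ji : (j == i) = false by rewrite eq_sym (negPf ij).
  have yi : (1 - t ^+ 2) * tnth x i - t * (2 * tnth x j) = (1 + t ^+ 2) * tnth y i.
    by rewrite tnth_mktuple sum_givens // eqxx; field.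
  have yj : t * (2 * tnth x i) + (1 - t ^+ 2) * tnth x j = (1 + t ^+ 2) * tnth y j.
    by rewrite tnth_mktuple sum_givens // ji eqxx; field.
  have yg : poly_fun g x = poly_fun g y.
    apply: g_indep => k ki kj.
    by rewrite tnth_mktuple sum_givens // (negPf ki) (negPf kj).
  rewrite /poly_fun in yg *.
  rewrite /G horner_rotated_monomial /f.
  rewrite mpoly.mevalZ !(mpoly.mevalM, mpoly.mevalXU, rmorphXn) /= yg.
  rewrite !(mpoly.mevalD, mpoly.mevalN, mpoly.mevalM, mpoly.mevalXU,
            mpoly.mevalC, mpoly.meval1, rmorphXn) /=.
  rewrite -[1 + 1]/(2 : R).
  rewrite yi yj !exprMn exprD; ring.
have /(congr1 (fun P : {poly R} => P`_1)) : P = (1 + 'X^2) ^+ (p + q) * (L f)%:P.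
  by apply: eq_poly_horner => t; rewrite PE GE !hornerE.
have -> : P`_1 = L G`_1.
  rewrite coef_poly; case: ltnP => // G_small.
  by rewrite nth_default // sphere_integral0.
have even_coef N : ((1 + 'X^2) ^+ N : {poly R})`_1 = 0.
  by rewrite coef1_deriv deriv_exp !poly.derivE !hornerMn !hornerE mul0rn.
have natZ k (h : mpoly.mpoly n R) : h *+ k = k%:R *: h by rewrite scaler_nat.
rewrite coefMC even_coef mul0r coef1_rotated_monomial 2!natZ.
rewrite -scaleNr sphere_integralD !sphere_integralZ mulNr => /eqP.
rewrite subr_eq0 !natrM -!mulrA => /eqP /mulfI; apply.
by rewrite pnatr_eq0.
Qed.

Local Notation add2 a i := (mpoly.mnm_add a (mpoly.mnm_muln (mpoly.mnm1 i) 2)).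

Lemma add2E a i k : add2 a i k = (a k + (i == k) * 2)%N.
Proof. by rewrite mpoly.mnmDE mpoly.mulmnE mpoly.mnm1E. Qed.

Lemma mdeg_add2 a i : mpoly.mdeg (add2 a i) = (mpoly.mdeg a).+2.
Proof. by rewrite mpoly.mdegD mpoly.mdegMn mpoly.mdeg1 mul1n addn2. Qed.

Lemma add2_sub a i : (1 < a i)%N -> exists b, a = add2 b i.
Proof.
move=> ai; exists (mpoly.mnm_sub a (mpoly.mnm_muln (mpoly.mnm1 i) 2)).
apply/mpoly.mnmP => k; rewrite add2E mpoly.mnmBE mpoly.mulmnE mpoly.mnm1E.
by have [<-|] := eqVneq i k; rewrite ?mul1n ?subnK // subn0 addn0.
Qed.

Lemma mpolyX_split i j a : i != j ->
  mpoly.mpolyX R a =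
    X i ^+ a i * X j ^+ a j * \prod_(k | (k != i) && (k != j)) X k ^+ a k.
Proof.
move=> ij; rewrite mpoly.mpolyXE_id (bigD1 i) //= (bigD1 j) 1?eq_sym //=.
by rewrite mulrA.
Qed.

Lemma poly_fun_prod_indep i j (e : 'I_n -> nat) (x y : n.-tuple R) :
  (forall k, k != i -> k != j -> tnth x k = tnth y k) ->
  poly_fun (\prod_(k | (k != i) && (k != j)) X k ^+ e k) x =
  poly_fun (\prod_(k | (k != i) && (k != j)) X k ^+ e k) y.
Proof.
move=> xy; rewrite /poly_fun !rmorph_prod; apply: eq_bigr => k /andP[ki kj].
by rewrite !rmorphXn /= !mpoly.mevalXU xy.
Qed.

Lemma sphere_integral_add2_swap i j a :
  (a j).+1%:R * L (mpoly.mpolyX R (add2 a i)) =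
  (a i).+1%:R * L (mpoly.mpolyX R (add2 a j)).
Proof.
have [->//|ij] := eqVneq i j.
have ji : (j == i) = false by rewrite eq_sym (negPf ij).
have := sphere_integral_deriv (a i).+1 (a j).+1 ij (@poly_fun_prod_indep i j a).
rewrite /= (mpolyX_split (add2 a i) ij) (mpolyX_split (add2 a j) ij).
rewrite !add2E !eqxx (negPf ij) ji !addn0 !addn2.
have tl (b : mpoly.multinom n) (k : 'I_n) : (k == i) || (k == j) ->
  \prod_(k0 | (k0 != i) && (k0 != j)) X k0 ^+ b k0 =
  \prod_(k0 | (k0 != i) && (k0 != j)) X k0 ^+ add2 b k k0.
  move=> kij; apply: eq_bigr => l /andP[li lj]; rewrite add2E.
  by case/orP: kij => /eqP ->; rewrite eq_sym ?(negPf li) ?(negPf lj) addn0.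
move: (tl a i) (tl a j); rewrite !eqxx orbT => /(_ isT) <- /(_ isT) <-.
exact.
Qed.

Lemma sphere_integral_add2_sum a :
  \sum_i L (mpoly.mpolyX R (add2 a i)) = L (mpoly.mpolyX R a).
Proof.
rewrite -sphere_integral_sum; apply: eq_sphere_integral => x Sx.
rewrite /poly_fun raddf_sum /= -[RHS]mul1r -[Z in _ = Z * _]Sx mulr_suml.
apply: eq_bigr => i _.
by rewrite mpoly.mpolyXD mpoly.mevalM mulrC -mpoly.mpolyXn rmorphXn /= mpoly.mevalXU.
Qed.

Lemma sphere_integral_add2 a j :
  (mpoly.mdeg a + n)%:R * L (mpoly.mpolyX R (add2 a j)) =
  (a j).+1%:R * L (mpoly.mpolyX R a).
Proof.
rewrite -(sphere_integral_add2_sum a) mulr_sumr.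
under eq_bigr => i _ do rewrite sphere_integral_add2_swap.
rewrite -mulr_suml -natr_sum; congr (_%:R * _).
under eq_bigr => i _ do rewrite -addn1.
by rewrite big_split /= -mpoly.mdegE sum1_card card_ord.
Qed.

Lemma sphere_integral_odd a i : (1 < n)%N -> odd (a i) -> L (mpoly.mpolyX R a) = 0.
Proof.
move=> n1; have [k] := ubnP (a i); elim: k a => // k IH a ak ai.
have [a1 | a1] := leqP (a i) 1; last first.
  have [b ab] := add2_sub a1; have abi : a i = (b i).+2.
    by rewrite ab add2E eqxx addn2.
  have Lb : L (mpoly.mpolyX R b) = 0.
    apply: IH; last by move: ai; rewrite abi /= negbK.
    by move: ak; rewrite abi ltnS => /ltnW.
  apply/eqP; move/eqP: (sphere_integral_add2 b i); rewrite -ab Lb mulr0.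
  by rewrite mulf_eq0 pnatr_eq0 addn_eq0 -[n == 0%N]leqn0 leqNgt (ltnW n1) andbF.
have {a1 ai} ai : a i = 1%N by case: (a i) a1 ai => [|[]].
have [j ij] : exists j, i != j.
  have n0' : (0 < n)%N by exact: ltnW.
  have [i0|i0] := eqVneq i (Ordinal n0'); last by exists (Ordinal n0').
  by exists (Ordinal n1); rewrite i0.
have := sphere_integral_deriv 0 (a j).+1 ij (@poly_fun_prod_indep i j a).
rewrite (mpolyX_split a ij) ai mul0r.
by move/eqP; rewrite mulf_eq0 pnatr_eq0 => /eqP.
Qed.

Lemma sphere_integral_monomial a k : (1 < n)%N -> mpoly.mdeg a = k.*2 ->
  L (mpoly.mpolyX R a) * \prod_(j < k) (n + j.*2)%:R =
  (\prod_i gauss_moment (a i))%N%:R.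
Proof.
move=> n1; elim: k a => [|k IH] a.
  move=> /eqP; rewrite mpoly.mdeg_eq0 => /eqP ->.
  rewrite mpoly.mpolyX0 big_ord0 mulr1 sphere_integral1 // big1 // => i _.
  by rewrite mpoly.mnm0E.
move=> deg_a; have [/forallP ev|] := boolP [forall i, ~~ odd (a i)]; last first.
  rewrite negb_forall => /existsP[i]; rewrite negbK => ai.
  by rewrite (sphere_integral_odd n1 ai) mul0r (bigD1 i) //= gauss_moment_odd.
have [j aj] : exists j, (0 < a j)%N.
  apply/existsP; apply: contra_eqT deg_a; rewrite negb_exists => /forallP a0.
  by rewrite mpoly.mdegE big1 // => i _; move: (a0 i); rewrite lt0n negbK => /eqP.
have {}aj : (1 < a j)%N by case: (a j) aj (ev j) => [|[]].
have [b ab] := add2_sub aj.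
have deg_b : mpoly.mdeg b = k.*2 by move: deg_a; rewrite ab mdeg_add2 doubleS => -[].
have := sphere_integral_add2 b j; rewrite -ab deg_b => E.
rewrite big_ord_recr /= mulrA mulrAC (mulrC (L _)) [(n + _)%N]addnC E -mulrA IH //.
rewrite -natrM; congr _%:R; rewrite (bigD1 j) //= [in RHS](bigD1 j) //= ab add2E eqxx addn2 /= mulnA.
congr (_ * _)%N; apply: eq_bigr => i ij.
by rewrite add2E eq_sym (negPf ij) addn0.
Qed.

Lemma sphere_integral_nodes (zs : seq (R * n.-tuple R)) (f : mpoly.mpoly n R) :
  (1 < n)%N ->
  (forall z, z \in zs -> \sum_i tnth z.2 i ^+ 2 = 1) ->
  (forall a, mpoly.mdeg a = 8%N ->
     L (mpoly.mpolyX R a) = \sum_(z <- zs) z.1 * signed_mean (tnth z.2) a) ->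
  degree_le 9 f ->
  L f = \sum_(z <- zs) z.1 * orbit_mean (poly_fun f) z.2.
Proof.
move=> n1 zs1 deg8 deg_f.
pose Q a := \sum_(z <- zs) z.1 * signed_mean (tnth z.2) a.
have LQ k a : (mpoly.mdeg a + k.*2)%N = 8%N -> L (mpoly.mpolyX R a) = Q a.
  elim: k a => [|k IH] a; first by rewrite addn0 => /deg8.
  rewrite doubleS !addnS => deg_a.
  rewrite -sphere_integral_add2_sum (eq_bigr (fun i => Q (add2 a i))) => [|i _].
    rewrite exchange_big /=; apply: eq_big_seq => z zzs.
    by rewrite -mulr_sumr signed_mean_sphere // zs1.
  by apply: IH; rewrite mdeg_add2.
rewrite [in LHS](mpoly.mpolyE f) sphere_integral_sum.
under [RHS]eq_bigr => z _ do rewrite orbit_mean_expand mulr_sumr.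
rewrite exchange_big /=; apply: eq_big_seq => a /mpoly.msize_mdeg_lt deg_a.
rewrite sphere_integralZ; under eq_bigr => z _ do rewrite mulrCA.
rewrite -mulr_sumr; congr (_ * _); rewrite -/(Q a).
have [/forallP ev|] := boolP [forall i, ~~ odd (a i)]; last first.
  rewrite negb_forall => /existsP[i]; rewrite negbK => ai.
  rewrite (sphere_integral_odd n1 ai) /Q big1 // => z _.
  by rewrite (signed_mean_odd _ ai) mulr0.
have {}deg_a : (mpoly.mdeg a <= 9)%N.
  by rewrite -ltnS; apply: leq_trans deg_a _.
have even_a : ~~ odd (mpoly.mdeg a).
  rewrite mpoly.mdegE; apply: (big_ind (fun k => ~~ odd k)) => // u v.
  by rewrite oddD => /negPf -> /negPf ->.
apply: (LQ (4 - (mpoly.mdeg a)./2)%N).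
by move: deg_a (even_halfK even_a); lia.
Qed.

End SphereMoments.

Section Nodes.
Variables (R : realType) (n : nat).

Lemma sum_ones_sqr (F : realFieldType) k : (k <= n)%N ->
  \sum_(i < n) @ones n F k i ^+ 2 = k%:R.
Proof.
move=> kn; rewrite -[in RHS](card_ord k) -sum1_card natr_sum.
rewrite (big_ord_widen _ (fun=> 1) kn) [RHS]big_mkcond; apply: eq_bigr => i _.
by rewrite /ones; case: (i < k)%N; rewrite ?expr1n ?expr0n.
Qed.

Lemma sum_three_ones_sqr (F : realFieldType) : (0 < n)%N ->
  \sum_(i < n) @three_ones n F i ^+ 2 = (9 + n.-1)%:R.
Proof.
case: n => // d _; rewrite big_ord_recl /three_ones /=.
rewrite (eq_bigr (fun=> 1)) => [|i _]; last by rewrite expr1n.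
by rewrite sumr_const card_ord -natrX -natrD.
Qed.

Section ScaledNode.
Variables (N : nat) (v : 'I_n -> rat) (y : n.-tuple R).
Hypotheses (N_gt0 : (0 < N)%N) (vN : \sum_i v i ^+ 2 = N%:R).
Hypothesis yE : forall i, tnth y i = (Num.sqrt N%:R)^-1 * ratr (v i).

Lemma scaled_node_sphere : \sum_i tnth y i ^+ 2 = 1.
Proof.
under eq_bigr => i _ do rewrite yE exprMn -rmorphXn.
rewrite -mulr_sumr -rmorph_sum vN rmorph_nat exprVn sqr_sqrtr ?ler0n //.
by rewrite mulVf // pnatr_eq0 -lt0n.
Qed.

Lemma scaled_node_moment8 a w : mpoly.mdeg a = 8%N ->
  ratr (N%:R ^+ 4 * w) * signed_mean (tnth y) a = ratr (w * signed_mean v a) :> R.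
Proof.
move=> a8; have -> : tnth y = fun i => (Num.sqrt N%:R)^-1 * ratr (v i).
  by apply/funext.
rewrite signed_mean_scale signed_mean_ratr a8 exprVn (exprM _ 2 4) sqr_sqrtr ?ler0n //.
rewrite [ratr (_ * w)]rmorphM [ratr (w * _)]rmorphM rmorphXn rmorph_nat mulrACA.
by rewrite mulfV ?mul1r // expf_neq0 // pnatr_eq0 -lt0n.
Qed.

End ScaledNode.
End Nodes.

Lemma sphere_norm8E (F : numFieldType) n :
  sphere_norm8 n%:R = (\prod_(j < 4) (n + j.*2))%N%:R :> F.
Proof. by rewrite !big_ord_recr big_ord0 /= mul1n addn0 !natrM !natrD. Qed.

Theorem mainTheorem6 :
  (forall d m : nat, admissible_pair d m ->
   exists l1 l2 l3 l4 l5 : rat,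
     [/\ 0 <= l1, 0 <= l2, 0 <= l3, 0 <= l4 & 0 <= l5] /\
     l1 + l2 + l3 + l4 + l5 = 1 /\
     forall (R : realType) (sigma : probability (d.+1.-tuple R) R),
       is_uniform_on_sphere sigma ->
     forall f : mpoly.mpoly d.+1 R, degree_le 9 f ->
       (\int[sigma]_(x in unit_sphere) (poly_fun f x)%:E)%E =
       (ratr l1 * orbit_mean (poly_fun f)
                    (scale_vec (Num.sqrt d.+1%:R)^-1 (ones_vec d.+1))
        + ratr l2 * orbit_mean (poly_fun f) (ones_vec 1)
        + ratr l3 * orbit_mean (poly_fun f)
                      (scale_vec (Num.sqrt 2)^-1 (ones_vec 2))
        + ratr l4 * orbit_mean (poly_fun f)
                      (scale_vec (Num.sqrt m%:R)^-1 (ones_vec m))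
        + ratr l5 * orbit_mean (poly_fun f)
                      (scale_vec (Num.sqrt (9 + d)%:R)^-1 three_ones_vec))%:E)
  /\
  (forall d : nat, (3 <= d <= 26)%N ->
   exists (N : nat) (c : 'I_N -> rat) (a : 'I_N -> 'I_d.+1 -> rat),
     (forall k, 0 < c k) /\
     (\sum_(i < d.+1) mvar i ^+ 2) ^+ 4 =
       \sum_(k < N) c k *: linear_form (a k) ^+ 8).
Proof.
split.
- move=> d m dm; have d3 : (3 <= d)%N by move: dm; rewrite /admissible_pair; lia.
  have [q1 q2 q3 M3 MN] := weight_nums_ge0 dm.
  have [w1 w2 w3 w4 w5] := weights_ge0 M3 MN q1 q2 q3.
  have N4 : 4 <= d.+1%:R :> rat by rewrite ler_nat.
  exists (d.+1%:R ^+ 4 * weight_ones d.+1%:R m%:R).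
  exists (1%:R ^+ 4 * weight_one d.+1%:R m%:R).
  exists (2%:R ^+ 4 * weight_two d.+1%:R m%:R).
  exists (m%:R ^+ 4 * weight_m d.+1%:R m%:R).
  exists ((9 + d)%:R ^+ 4 * weight_three d.+1%:R).
  split; first by split; apply: mulr_ge0 => //; apply: exprn_ge0; exact: ler0n.
  split.
    rewrite (_ : (9 + d)%N = (d.+1 + 8)%N); last by rewrite addSnnS addnC.
    by rewrite natrD; exact: weights_sum.
  move=> R sigma sigma_uniform f deg_f.
  have n1 : (1 < d.+1)%N by rewrite ltnS; apply: leq_trans d3.
  have m0 : (0 < m)%N by rewrite -(ltr_nat rat); apply: lt_le_trans M3.
  have md : (m <= d.+1)%N by rewrite -(ler_nat rat); apply: le_trans MN; rewrite lerDl.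
  have onesE N k i : tnth (scale_vec (Num.sqrt N%:R)^-1 (ones_vec k)) i =
      (Num.sqrt N%:R)^-1 * ratr (@ones d.+1 rat k i) :> R.
    by rewrite !tnth_mktuple rmorph_nat.
  have ones1E i : tnth (ones_vec 1) i =
      (Num.sqrt 1%:R)^-1 * ratr (@ones d.+1 rat 1 i) :> R.
    by rewrite tnth_mktuple rmorph_nat sqrtr1 invr1 mul1r.
  have threeE i : tnth (scale_vec (Num.sqrt (9 + d)%:R)^-1 three_ones_vec) i =
      (Num.sqrt (9 + d)%:R)^-1 * ratr (@three_ones d.+1 rat i) :> R.
    by rewrite !tnth_mktuple /three_ones; case: ifP => _; rewrite ?rmorph1 ?ratr_nat.
  have S1 := sum_ones_sqr rat (leqnn d.+1).
  have S2 := sum_ones_sqr rat (ltnW n1).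
  have S3 := sum_ones_sqr rat n1.
  have S4 := sum_ones_sqr rat md.
  have S5 := sum_three_ones_sqr rat (ltn0Sn d).
  rewrite sphere_integralE; congr EFin.
  pose zs : seq (R * d.+1.-tuple R) :=
    [:: (ratr (d.+1%:R ^+ 4 * weight_ones d.+1%:R m%:R),
         scale_vec (Num.sqrt d.+1%:R)^-1 (ones_vec d.+1));
        (ratr (1%:R ^+ 4 * weight_one d.+1%:R m%:R), ones_vec 1);
        (ratr (2%:R ^+ 4 * weight_two d.+1%:R m%:R),
         scale_vec (Num.sqrt 2%:R)^-1 (ones_vec 2));
        (ratr (m%:R ^+ 4 * weight_m d.+1%:R m%:R),
         scale_vec (Num.sqrt m%:R)^-1 (ones_vec m));
        (ratr ((9 + d)%:R ^+ 4 * weight_three d.+1%:R),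
         scale_vec (Num.sqrt (9 + d)%:R)^-1 three_ones_vec)].
  rewrite (sphere_integral_nodes sigma_uniform (zs := zs) n1 _ _ deg_f).
  + by rewrite /zs !big_cons big_nil /= addr0 !addrA.
  + move=> z; rewrite !inE => /or4P[/eqP->|/eqP->|/eqP->|/orP[/eqP->|/eqP->]] /=.
    * exact: scaled_node_sphere S1 (onesE _ _).
    * exact: scaled_node_sphere S2 ones1E.
    * exact: scaled_node_sphere S3 (onesE _ _).
    * exact: scaled_node_sphere S4 (onesE _ _).
    * exact: scaled_node_sphere S5 threeE.
  move=> a a8.
  rewrite /zs !big_cons big_nil /= addr0.
  rewrite (scaled_node_moment8 (ltn0Sn d) (onesE _ _) _ a8).
  rewrite (scaled_node_moment8 (ltn0Sn 0) ones1E _ a8).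
  rewrite (scaled_node_moment8 (ltn0Sn 1) (onesE _ _) _ a8).
  rewrite (scaled_node_moment8 m0 (onesE _ _) _ a8).
  rewrite (scaled_node_moment8 (ltn0Sn (8 + d)) threeE _ a8).
  have := weighted_nodes_moment8 N4 M3 MN a8.
  rewrite /weighted_nodes !big_cons big_nil addr0 => E.
  rewrite -4!rmorphD E fmorph_div sphere_norm8E !rmorph_nat.
  have K0 : \prod_(j < 4) (d.+1 + j.*2)%:R != 0 :> R.
    by apply/prodf_neq0 => j _; rewrite pnatr_eq0.
  by rewrite -(sphere_integral_monomial sigma_uniform (k := 4) n1 a8) natr_prod (mulfK K0).
- move=> d /andP[d3 d26]; pose m := ((d + 9) %/ 4)%N.
  have dm : admissible_pair d m by rewrite /m /admissible_pair; lia.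
  have [q1 q2 q3 M3 MN] := weight_nums_ge0 dm.
  have N4 : 4 <= d.+1%:R :> rat by rewrite ler_nat.
  exact: (sum_squares_pow4 N4 M3 MN (weights_ge0 M3 MN q1 q2 q3)).
Qed.
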